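(* Let $q$ be a prime power, $s\geq 3$, and let $\mathbf{c}=(c_1,\dots,c_s)\in\mathbb{F}_q[t]^s$ with all $c_i\neq 0$ and $c_1+\cdots+c_s=0$, so that the equation $c_1x_1+\cdots+c_sx_s=0$ has genus $m\geq 1$. Let $\ell=\max_i\deg c_i$. For a positive integer $N$ let $G_N$ be the set of polynomials in $\mathbb{F}_q[t]$ of degree strictly less than $N$, and let $r_{s,\mathbf{c}}(N)$ be the largest cardinality of a subset of $G_N$ containing no non-trivial solutions $(x_1,\dots,x_s)$ to $c_1x_1+\cdots+c_sx_s=0$ (in $\mathbb{F}_q[t]$). Then there is a constant $C>0$ depending only on $s$, $\ell$ and $q$ such that for all $N\geq 2$, \[r_{s,\mathbf{c}}(N)\leq C\,q^N\left(\frac{(\log N)^4}{N}\right)^{s-2}.\]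
   Context: The genus of an equation $c_1x_1+\cdots+c_sx_s=0$ with $c_1+\cdots+c_s=0$ is the largest $m$ such that $\{1,\dots,s\}$ can be partitioned into $m$ disjoint nonempty sets $T_1,\dots,T_m$ with $\sum_{i\in T_j}c_i=0$ for each $j$. A solution $(x_1,\dots,x_s)\in A^s$ is trivial if there is such a partition into $m$ (= genus) parts with $x_i=x_{i'}$ whenever $i,i'$ lie in the same part $T_j$; otherwise it is non-trivial. *)

(* Defs.v *)
From mathcomp Require Import all_boot all_algebra.

Set Implicit Arguments.
Unset Strict Implicit.
Unset Printing Implicit Defensive.

Import GRing.Theory.
Local Open Scope ring_scope.

Section Genus.
Variables (F : finFieldType) (s : nat) (c : 'I_s -> {poly F}).

Definition zero_sum_partition (P : {set {set 'I_s}}) : bool :=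
  partition P [set: 'I_s] && [forall T in P, \sum_(i in T) c i == 0].

Definition genus : nat := (\max_(P | zero_sum_partition P) #|P|)%N.

Definition trivial_tuple (x : 'I_s -> {poly F}) : bool :=
  [exists P, [&& zero_sum_partition P, #|P| == genus &
    [forall T in P, forall i in T, forall j in T, x i == x j]]].

Definition nontrivial_solution (x : 'I_s -> {poly F}) : bool :=
  (\sum_i c i * x i == 0) && ~~ trivial_tuple x.

(* The type [{poly_N F}] of polynomials of size at most [N], i.e. of degree
   strictly less than [N], is G_N; the equation itself is over [{poly F}]. *)
Definition solution_free (N : nat) (A : {set {poly_N F}}) : bool :=
  [forall x : {ffun 'I_s -> {poly_N F}},
     [forall i, x i \in A] ==> ~~ nontrivial_solution (fun i => x i)].

Definition max_solution_free (N : nat) : nat :=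
  (\max_(A : {set {poly_N F}} | solution_free A) #|A|)%N.

Lemma genus_gt0 : (0 < s)%N -> \sum_i c i = 0 -> (0 < genus)%N.
Proof.
move=> s_gt0 c0; rewrite -(cards1 [set: 'I_s]).
apply: (@leq_bigmax_cond _ _ (fun P : {set {set 'I_s}} => #|P|)).
apply/andP; split; last first.
  apply/forall_inP => T /set1P ->.
  by apply/eqP; rewrite -[RHS]c0; apply: eq_bigl => i; rewrite inE.
apply/and3P; split; first by rewrite /cover big_set1.
  by apply/trivIsetP => A B /set1P -> /set1P ->; rewrite eqxx.
by apply/set1P => /setP /(_ (Ordinal s_gt0)); rewrite !inE.
Qed.

End Genus.

(* Main.v *)
Require Import Defs.
From mathcomp Require Import all_boot all_order all_algebra.
From mathcomp Require Import finfield zify ring lra.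
From mathcomp Require Import reals sequences exp.

(** Let [P] be a zero-sum partition with [genus c] parts and [A] a solution-free
    set. A solution taking more than [genus c] values is non-trivial, so if some
    of the parts carry a solution with more values than there are such parts,
    giving the other parts fresh distinct values from [A] yields a
    contradiction.

    If some part has at least three indices, identifying all but two of its
    variables gives an equation [a x + b y + d z = 0] with [a + b + d = 0] whose
    solutions in [A] are all diagonal. The indicator of
    [a x + b y + d z = 0] is a polynomial of degree at most
    [(q - 1) (N + ell)] in the coefficients of [x, y, z], so the slice rank
    argument of Croot-Lev-Pach, Ellenberg-Gijswijt and Tao bounds [#|A|] by
    three times the number of reduced monomials of a third of that degree,
    which is [O((theta q) ^ N)] for some [theta < 1]. Otherwise all parts are
    pairs, and a collision of [c_i x + c_j y] between two halves of [A] would be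
    a forbidden solution, whence [#|A| ^ 2 = O(q ^ N)]. Both bounds save an
    exponential factor, which beats the required power of [N]. *)

Set Implicit Arguments.
Unset Strict Implicit.
Unset Printing Implicit Defensive.
Import Order.TTheory GRing.Theory Num.Theory.
Local Open Scope ring_scope.

(** * Linear algebra: the slice rank of a diagonal tensor *)

Lemma mxrank_mxsub_leq (F : fieldType) (m n m' n' : nat)
    (f : 'I_m' -> 'I_m) (g : 'I_n' -> 'I_n) (A : 'M[F]_(m, n)) :
  (\rank (mxsub f g A) <= \rank A)%N.
Proof.
have -> : mxsub f g A = rowsub f 1%:M *m A *m colsub g 1%:M.
  rewrite -mulmxA mulmx_colsub mulmx1 -rowsubE.
  by apply/matrixP => i j; rewrite !mxE.
exact: leq_trans (mxrankM_maxl _ _) (mxrankM_maxr _ _).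
Qed.

(** The left kernel of [U] has dimension at least [n - m], and a space of dimension [r] contains a
    vector equal to 1 on some [r] coordinates. *)
Lemma exists_kernel_large_support (F : fieldType) (n m : nat)
    (U : 'M[F]_(n, m)) :
  exists2 v : 'rV[F]_n, v *m U = 0 & (n - m <= \rank (diag_mx v))%N.
Proof.
set B := row_base (kermx U).
have fullB : row_full B^T by rewrite /row_full mxrank_tr eq_row_base.
set f := fullrankfun fullB.
(* The columns [f] of [B] form an invertible matrix; after multiplication by its inverse they become
   the identity, and the sum of the rows is 1 on all of [f]. *)
pose v : 'rV_n := const_mx 1 *m invmx (rowsub f B^T)^T *m B.
have vU : v *m U = 0.
  apply/eqP; rewrite -sub_kermx (submx_trans (submxMl _ _)) //.
  by rewrite eq_row_base.
have vf i : v 0 (f i) = 1.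
  have : colsub f v = const_mx 1.
    have subB : colsub f B = (rowsub f B^T)^T.
      by apply/matrixP => i1 j1; rewrite !mxE.
    rewrite /v -mulmx_colsub subB -mulmxA mulVmx ?mulmx1 //.
    by rewrite unitmx_tr fullrowsub_unit.
  by move/rowP/(_ i); rewrite !mxE.
move: (v) vU vf => {}v vU vf.
exists v => //; apply: leq_trans (mxrank_mxsub_leq f f _).
have -> : mxsub f f (diag_mx v) = 1%:M.
  apply/matrixP => i j; rewrite !mxE (inj_eq (@fullrankfun_inj _ _ _ _ fullB)).
  by rewrite vf.
by rewrite mxrank1 mxrank_ker leq_sub2l // rank_leq_col.
Qed.

(** Contract the index [k] with a kernel vector [v] of large support. The slices in [k] vanish, the
    other two families become matrices of rank at most [m], and the left side becomes [diag_mx v],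
    so [n - m <= 2 * m]. *)
Lemma diagonal_slice_rank (F : fieldType) (n m : nat) (U : 'M[F]_(n, m))
    (g1 g2 g3 : 'I_m -> 'I_n -> 'I_n -> F) :
  (forall i j k, ((i == j) && (j == k))%:R =
     \sum_t U i t * g1 t j k + \sum_t U j t * g2 t i k
       + \sum_t U k t * g3 t i j) ->
  (n <= 3 * m)%N.
Proof.
move=> slices; have [v vU rank_v] := exists_kernel_large_support U.
pose G1 := \matrix_(t, j) \sum_k v 0 k * g1 t j k.
pose G2 := \matrix_(i, t) \sum_k v 0 k * g2 t i k.
have diagE : diag_mx v = U *m G1 + G2 *m U^T.
  apply/matrixP => i j; rewrite !mxE.
  have -> : v 0 i *+ (i == j) = \sum_k v 0 k * ((i == j) && (j == k))%:R.
    rewrite (bigD1 j) //= eqxx andbT big1 ?addr0 => [|k /negPf nkj].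
      by case: eqP => [->|]; rewrite ?mulr1 ?mulr0.
    by rewrite [j == k]eq_sym nkj andbF mulr0.
  under eq_bigr => k _ do rewrite slices !mulrDr.
  have kerU t : \sum_k v 0 k * U k t = 0.
    by move/rowP/(_ t): vU; rewrite !mxE.
  rewrite !big_split /= [X in _ + X = _](_ : _ = 0) ?addr0; last first.
    under eq_bigr do rewrite mulr_sumr; rewrite exchange_big big1 //= => t _.
    by under eq_bigr do rewrite mulrA; rewrite -mulr_suml kerU mul0r.
  congr (_ + _); under eq_bigr do rewrite mulr_sumr.
    rewrite exchange_big; apply: eq_bigr => t _; rewrite mxE mulr_sumr.
    by apply: eq_bigr => k _; rewrite mulrCA.
  rewrite exchange_big; apply: eq_bigr => t _; rewrite !mxE mulr_suml.
  by apply: eq_bigr => k _; rewrite -mulrA [g2 _ _ _ * _]mulrC.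
have rank_le : (\rank (diag_mx v) <= m + m)%N.
  rewrite diagE (leq_trans (mxrank_add _ _)) // leq_add //.
    by rewrite (leq_trans (mxrankM_maxl _ _)) // rank_leq_col.
  by rewrite (leq_trans (mxrankM_maxl _ _)) // rank_leq_col.
lia.
Qed.

(** * Functions of low degree in the coefficients of three polynomials *)

Lemma size_mul_npoly (R : nzSemiRingType) (N l : nat) (p : {poly R})
    (u : {poly_N R}) :
  (size p <= l.+1)%N -> (size (p * u)%R <= N + l)%N.
Proof.
move=> sp; apply: leq_trans (size_polyMleq _ _) _.
by have := size_npoly u; lia.
Qed.

Section LowDegree.
Variables (F : finFieldType) (N : nat).

Let expo := {ffun 'I_N -> 'I_#|F|}.

Definition monom (e : expo) (x : {poly_N F}) : F := \prod_(i < N) x`_i ^+ e i.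

Definition mdeg (e : expo) : nat := (\sum_(i < N) e i)%N.

(* Exponents stay below [#|F|] because [c ^+ #|F| = c] in [F]. *)
Lemma coef_mul_monom (i : 'I_N) (e : expo) :
  exists2 e', (mdeg e' <= (mdeg e).+1)%N &
    forall x : {poly_N F}, x`_i * monom e x = monom e' x.
Proof.
have [k le_k kE] : exists2 k : 'I_#|F|, (k <= (e i).+1)%N &
    forall a : F, a * a ^+ e i = a ^+ k.
  have := ltn_ord (e i); rewrite leq_eqVlt => /orP[/eqP eq_q|lt_q].
    exists (Ordinal (finNzRing_gt1 F)) => // a.
    by rewrite -exprS eq_q expf_card expr1.
  by exists (Ordinal lt_q) => // a; rewrite -exprS.
exists [ffun j => if j == i then k else e j].
  rewrite /mdeg (bigD1 i) //= [X in (_ <= X.+1)%N](bigD1 i) //= ffunE eqxx.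
  rewrite -addSn leq_add // leq_eqVlt; apply/orP; left; apply/eqP.
  by apply: eq_bigr => j /negPf nji; rewrite ffunE nji.
move=> x; rewrite /monom (bigD1 i) //= [RHS](bigD1 i) //= ffunE eqxx mulrA kE.
by congr (_ * _); apply: eq_bigr => j /negPf nji; rewrite ffunE nji.
Qed.

(** These are the functions given by reduced polynomials of degree at most [D] in the [3 * N]
    coefficients. The equations are pointwise, so that no functional extensionality is required. *)
Inductive lowdeg (D : nat) (f : {poly_N F} -> {poly_N F} -> {poly_N F} -> F) :
    Prop :=
| Lowdeg_monom a e1 e2 e3 of (mdeg e1 + mdeg e2 + mdeg e3 <= D)%N
    & (forall x y z, f x y z = a * (monom e1 x * monom e2 y * monom e3 z))
| Lowdeg_add g h of lowdeg D g & lowdeg D h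
    & (forall x y z, f x y z = g x y z + h x y z).

Lemma lowdeg_ext D f g :
  lowdeg D f -> (forall x y z, g x y z = f x y z) -> lowdeg D g.
Proof.
case=> [a e1 e2 e3 le_D fE|f1 f2 f1D f2D fE] gE.
  by apply: (@Lowdeg_monom D g a e1 e2 e3) => // x y z; rewrite gE.
by apply: Lowdeg_add f1D f2D _ => x y z; rewrite gE.
Qed.

Lemma lowdeg_const D a : lowdeg D (fun _ _ _ => a).
Proof.
have q0 : (0 < #|F|)%N := ltnW (finNzRing_gt1 F).
pose e0 : expo := [ffun=> Ordinal q0].
have e0deg : mdeg e0 = 0%N.
  by rewrite /mdeg big1 // => i _; rewrite ffunE.
have e0E x : monom e0 x = 1.
  by rewrite /monom big1 // => i _; rewrite ffunE.
apply: (@Lowdeg_monom D _ a e0 e0 e0); first by rewrite e0deg.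
by move=> x y z; rewrite !e0E !mulr1.
Qed.

Lemma lowdeg_scale D a f : lowdeg D f -> lowdeg D (fun x y z => a * f x y z).
Proof.
elim=> {f} [f b e1 e2 e3 le_D fE|f g h _ gD _ hD fE].
  by apply: (@Lowdeg_monom D _ (a * b) e1 e2 e3) => // x y z; rewrite fE mulrA.
by apply: Lowdeg_add gD hD _ => x y z; rewrite fE mulrDr.
Qed.

Lemma lowdeg_leq D D' f : (D <= D')%N -> lowdeg D f -> lowdeg D' f.
Proof.
move=> le_DD'; elim=> {f} [f b e1 e2 e3 le_D fE|f g h _ gD _ hD fE].
  by apply: (@Lowdeg_monom D' _ b e1 e2 e3) => //; apply: leq_trans le_DD'.
exact: Lowdeg_add gD hD _.
Qed.

Lemma lowdeg_sum D (I : Type) (r : seq I) f :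
  (forall i, lowdeg D (f i)) ->
  lowdeg D (fun x y z => \sum_(i <- r) f i x y z).
Proof.
move=> fD; elim: r => [|i r IHr].
  by apply: lowdeg_ext (lowdeg_const D 0) _ => x y z; rewrite big_nil.
by apply: Lowdeg_add (fD i) IHr _ => x y z; rewrite big_cons.
Qed.

Lemma lowdeg_mul_coef1 D f (j : nat) :
  lowdeg D f -> lowdeg D.+1 (fun x y z => x`_j * f x y z).
Proof.
have [lt_jN|le_Nj] := ltnP j N; last first.
  move=> _; apply: lowdeg_ext (lowdeg_const D.+1 0) _ => x y z.
  by rewrite nth_default ?mul0r // (leq_trans (size_npoly x)).
elim=> {f} [f b e1 e2 e3 le_D fE|f g h _ gD _ hD fE].
  have [e' le_e' e'E] := coef_mul_monom (Ordinal lt_jN) e1.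
  apply: (@Lowdeg_monom D.+1 _ b e' e2 e3); first lia.
  by move=> x y z; rewrite fE -e'E /=; ring.
by apply: Lowdeg_add gD hD _ => x y z; rewrite fE mulrDr.
Qed.

Lemma lowdeg_mul_coef2 D f (j : nat) :
  lowdeg D f -> lowdeg D.+1 (fun x y z => y`_j * f x y z).
Proof.
have [lt_jN|le_Nj] := ltnP j N; last first.
  move=> _; apply: lowdeg_ext (lowdeg_const D.+1 0) _ => x y z.
  by rewrite nth_default ?mul0r // (leq_trans (size_npoly y)).
elim=> {f} [f b e1 e2 e3 le_D fE|f g h _ gD _ hD fE].
  have [e' le_e' e'E] := coef_mul_monom (Ordinal lt_jN) e2.
  apply: (@Lowdeg_monom D.+1 _ b e1 e' e3); first lia.
  by move=> x y z; rewrite fE -e'E /=; ring.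
by apply: Lowdeg_add gD hD _ => x y z; rewrite fE mulrDr.
Qed.

Lemma lowdeg_mul_coef3 D f (j : nat) :
  lowdeg D f -> lowdeg D.+1 (fun x y z => z`_j * f x y z).
Proof.
have [lt_jN|le_Nj] := ltnP j N; last first.
  move=> _; apply: lowdeg_ext (lowdeg_const D.+1 0) _ => x y z.
  by rewrite nth_default ?mul0r // (leq_trans (size_npoly z)).
elim=> {f} [f b e1 e2 e3 le_D fE|f g h _ gD _ hD fE].
  have [e' le_e' e'E] := coef_mul_monom (Ordinal lt_jN) e3.
  apply: (@Lowdeg_monom D.+1 _ b e1 e2 e'); first lia.
  by move=> x y z; rewrite fE -e'E /=; ring.
by apply: Lowdeg_add gD hD _ => x y z; rewrite fE mulrDr.
Qed.

(** By the convolution formula the factor is a linear form in the coefficients of [x], [y] and [z],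
    so it costs one degree. *)
Lemma lowdeg_mul_form D f (a b d : {poly F}) (j : nat) :
  lowdeg D f ->
  lowdeg D.+1 (fun x y z => (a * x + b * y + d * z)`_j * f x y z).
Proof.
move=> fD.
have formD (g : nat -> {poly_N F} -> {poly_N F} -> {poly_N F} -> F)
    (p : {poly F}) :
    (forall i, lowdeg D.+1 (g i)) ->
    lowdeg D.+1 (fun x y z => \sum_(i < j.+1) p`_(j - i) * g i x y z).
  by move=> gD; apply: lowdeg_sum => i; apply: lowdeg_scale.
apply: Lowdeg_add (Lowdeg_add (formD _ a _) (formD _ b _) (fun _ _ _ => erefl))
  (formD _ d _) _ => [i|i|i|].
- exact: lowdeg_mul_coef1 i fD.
- exact: lowdeg_mul_coef2 i fD.
- exact: lowdeg_mul_coef3 i fD.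
move=> x y z; rewrite !coefD !coefMr !mulrDl !mulr_suml.
by congr (_ + _ + _); apply: eq_bigr => i _; rewrite mulrA.
Qed.

(** Since [a ^+ #|F|.-1 = 1] for [a != 0], each factor is the indicator of a vanishing coefficient;
    for [p != 0] the leading coefficient kills the product. *)
Lemma eq0_prod_coef n (p : {poly F}) : (size p <= n)%N ->
  (p == 0)%:R = \prod_(j < n) (1 - p`_j ^+ #|F|.-1) :> F.
Proof.
have q1 := finNzRing_gt1 F.
move=> le_pn; have [->|p0] := eqVneq p 0.
  rewrite big1 // => j _; rewrite coef0 expr0n.
  by rewrite -[_ == 0%N]negbK -lt0n -ltnS prednK ?q1 ?subr0 // ltnW.
have lt_n : ((size p).-1 < n)%N.
  by rewrite (leq_trans _ le_pn) // prednK // lt0n size_poly_eq0.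
rewrite (bigD1 (Ordinal lt_n)) //= -lead_coefE.
have lead0 : lead_coef p != 0 by rewrite lead_coef_eq0.
suff -> : lead_coef p ^+ #|F|.-1 = 1 by rewrite subrr mul0r.
apply: (mulfI lead0); rewrite -exprS prednK ?mulr1 ?expf_card //.
exact: ltnW.
Qed.

(** There are [N + l] coefficients to test, each by a factor of degree [#|F|.-1]. *)
Lemma lowdeg_eq0 (a b d : {poly F}) l :
  (size a <= l.+1)%N -> (size b <= l.+1)%N -> (size d <= l.+1)%N ->
  lowdeg (#|F|.-1 * (N + l)) (fun x y z => (a * x + b * y + d * z == 0)%:R).
Proof.
move=> sa sb sd.
have size_form x y z : (size (a * (x : {poly_N F}) + b * (y : {poly_N F})
    + d * (z : {poly_N F}))%R <= N + l)%N.
  rewrite (leq_trans (size_polyD _ _)) // geq_max size_mul_npoly // andbT.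
  by rewrite (leq_trans (size_polyD _ _)) // geq_max !size_mul_npoly.
pose p x y z := a * (x : {poly_N F}) + b * (y : {poly_N F})
  + d * (z : {poly_N F}).
have powD k D f j : lowdeg D f ->
    lowdeg (k + D) (fun x y z => (p x y z)`_j ^+ k * f x y z).
  move=> fD; elim: k => [|k IHk].
    by apply: lowdeg_ext fD _ => x y z; rewrite expr0 mul1r.
  apply: lowdeg_ext (lowdeg_mul_form a b d j IHk) _ => x y z.
  by rewrite exprS mulrA.
suff prodD n : lowdeg (#|F|.-1 * n)
    (fun x y z => \prod_(j < n) (1 - (p x y z)`_j ^+ #|F|.-1)).
  by apply: lowdeg_ext (prodD _) _ => x y z; apply: eq0_prod_coef.
elim: n => [|n IHn].
  by apply: lowdeg_ext (lowdeg_const _ 1) _ => x y z; rewrite big_ord0.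
apply: Lowdeg_add (lowdeg_leq _ IHn)
    (lowdeg_leq _ (lowdeg_scale (-1) (powD #|F|.-1 _ _ n IHn))) _.
- by rewrite leq_mul2l leqnSn orbT.
- by rewrite mulnS.
by move=> x y z; rewrite big_ord_recr /=; ring.
Qed.

Definition small_expos (D : nat) : {set expo} := [set e | (3 * mdeg e <= D)%N].

(** Of three degrees with sum at most [D], one is at most [D / 3]. That monomial is pulled out, and
    the other two go into the cofactor. *)
Lemma lowdeg_slices D f : lowdeg D f ->
  exists g1 g2 g3 : expo -> {poly_N F} -> {poly_N F} -> F,
  forall x y z, f x y z =
    \sum_(e in small_expos D) monom e x * g1 e y z
    + \sum_(e in small_expos D) monom e y * g2 e x z
    + \sum_(e in small_expos D) monom e z * g3 e x y.
Proof.
pose zero (e : expo) (x y : {poly_N F}) : F := 0.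
have zeroE (h : expo -> F) x y :
    \sum_(e in small_expos D) h e * zero e x y = 0.
  by rewrite big1 // => e _; rewrite mulr0.
have pick (h : expo -> F) (e0 : expo) c : (3 * mdeg e0 <= D)%N ->
    \sum_(e in small_expos D) h e * (if e == e0 then c else 0) = h e0 * c.
  move=> le_e0; rewrite (bigD1 e0) ?inE //= eqxx big1 ?addr0 //.
  by move=> e /andP[_ /negPf->]; rewrite mulr0.
elim=> {f} [f a e1 e2 e3 le_D fE|f g h _ [g1 [g2 [g3 gE]]]
    _ [h1 [h2 [h3 hE]]] fE]; last first.
  exists (fun e x y => g1 e x y + h1 e x y), (fun e x y => g2 e x y + h2 e x y),
    (fun e x y => g3 e x y + h3 e x y) => x y z.
  have sumD (u v w : expo -> F) : \sum_(e in small_expos D) u e * (v e + w e) =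
      \sum_(e in small_expos D) u e * v e + \sum_(e in small_expos D) u e * w e.
    by rewrite -big_split; apply: eq_bigr => e _; rewrite mulrDr.
  by rewrite fE gE hE !sumD; ring.
have [le1|lt1] := leqP (3 * mdeg e1) D.
  exists (fun e y z => if e == e1 then a * (monom e2 y * monom e3 z) else 0),
    zero, zero => x y z.
  by rewrite pick // !zeroE fE; ring.
have [le2|lt2] := leqP (3 * mdeg e2) D.
  exists zero, (fun e x z => if e == e2 then a * (monom e1 x * monom e3 z) else 0),
    zero => x y z.
  by rewrite pick // !zeroE fE; ring.
have [le3|lt3] := leqP (3 * mdeg e3) D; last by lia.
exists zero, zero,
  (fun e x y => if e == e3 then a * (monom e1 x * monom e2 y) else 0) => x y z.
by rewrite pick // !zeroE fE; ring.
Qed.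

(** Diagonal triples are solutions because [a + b + d = 0], so on [A] the indicator of the equation
    is exactly the diagonal tensor, with slices indexed by the small exponents. *)
Lemma card_only_diagonal_solutions (A : {set {poly_N F}}) (a b d : {poly F}) l :
  (size a <= l.+1)%N -> (size b <= l.+1)%N -> (size d <= l.+1)%N ->
  a + b + d = 0 ->
  {in A & &, forall x y z : {poly_N F},
     a * x + b * y + d * z = 0 -> x = y /\ y = z} ->
  (#|A| <= 3 * #|small_expos (#|F|.-1 * (N + l))|)%N.
Proof.
move=> sa sb sd abd diagA.
have [g1 [g2 [g3 gE]]] := lowdeg_slices (lowdeg_eq0 sa sb sd).
set M := small_expos _ in gE *.
pose X (i : 'I_#|A|) := enum_val i.
pose U := \matrix_(i < #|A|, t < #|M|) monom (enum_val t) (X i).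
have sumE i (h : expo -> F) : \sum_t U i t * h (enum_val t) =
    \sum_(e in M) monom e (X i) * h e.
  by rewrite [RHS]big_enum_val; apply: eq_bigr => t _; rewrite mxE.
apply: (@diagonal_slice_rank F _ _ U (fun t j k => g1 (enum_val t) (X j) (X k))
  (fun t i k => g2 (enum_val t) (X i) (X k))
  (fun t i j => g3 (enum_val t) (X i) (X j))) => i j k.
rewrite (sumE i (fun e => g1 e (X j) (X k))) (sumE j (fun e => g2 e (X i) (X k))).
rewrite (sumE k (fun e => g3 e (X i) (X j))).
rewrite -gE; congr (_%:R); congr nat_of_bool.
apply/andP/eqP => [[/eqP<- /eqP<-]|].
  by rewrite -!mulrDl abd mul0r.
move/(diagA _ _ _ (enum_valP i) (enum_valP j) (enum_valP k)) => [eq1 eq2].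
by rewrite (enum_val_inj eq1) (enum_val_inj eq2).
Qed.

End LowDegree.

(** * Real estimates: the exponential saving and its comparison with the logarithmic bound *)

(** Rankin's trick: the right side expands to the sum of [y ^+ (3 * mdeg e)] over all [e], and each
    small [e] contributes at least [y ^+ D] as [y <= 1]. *)
Lemma card_small_expos_le (R : realFieldType) (F : finFieldType) (N D : nat)
    (y : R) : 0 < y <= 1 ->
  #|small_expos F N D|%:R * y ^+ D <= (\sum_(i < #|F|) y ^+ (3 * i)) ^+ N.
Proof.
move=> /andP[y0 y1]; rewrite -[X in _ <= _ ^+ X]card_ord -prodr_const.
rewrite (bigA_distr_bigA (fun (_ : 'I_N) (i : 'I_#|F|) => y ^+ (3 * i))) /=.
have prodE (e : {ffun 'I_N -> 'I_#|F|}) :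
    \prod_i y ^+ (3 * e i) = y ^+ (3 * mdeg e).
  by rewrite /mdeg big_distrr /= -prodrXr.
rewrite (bigID (mem (small_expos F N D))) /= mulr_natl -sumr_const.
rewrite -[leLHS]addr0 lerD //.
  apply: ler_sum => e; rewrite inE prodE => le_D.
  by rewrite ler_wiXn2l // ltW.
by apply: sumr_ge0 => e _; rewrite prodE exprn_ge0 // ltW.
Qed.

Lemma exprn_quadratic_bounds (R : realFieldType) (h : R) (n : nat) :
  0 <= h <= 1 -> 1 - n%:R * h <= (1 - h) ^+ n <= 1 - n%:R * h + (n%:R * h) ^+ 2.
Proof.
move=> h01; elim: n => [|n IHn]; first by rewrite expr0; lra.
rewrite exprS -natr1; have n0 : (0 : R) <= n%:R by [].
set m : R := n%:R in IHn n0 *; set p := (1 - h) ^+ n in IHn *.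
have p0 : 0 <= p by rewrite exprn_ge0 //; lra.
have mh2 : 0 <= m * h * h by rewrite !mulr_ge0 //; lra.
have mh3 : 0 <= m * h * (m * h) * h by rewrite !mulr_ge0 //; lra.
have hh : 0 <= h * h by rewrite mulr_ge0 //; lra.
have h0 : 0 <= 1 - h by lra.
move: IHn => /andP[lo hi]; apply/andP; split.
  by have := ler_wpM2l h0 lo; lra.
by have := ler_wpM2l h0 hi; rewrite !expr2; lra.
Qed.

(* To first order at [y = 1], the exponents [3 * i] average to
   [3 * (q - 1) / 2 > q - 1]. *)
Lemma exists_saving_ratio (R : realFieldType) (q : nat) : (2 <= q)%N ->
  exists2 y : R, 0 < y <= 1 & \sum_(i < q) y ^+ (3 * i) < q%:R * y ^+ q.-1.
Proof.
move=> q2; have q2R : (2 : R) <= q%:R by rewrite ler_nat.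
(* At [y = 1 - h] the first-order gain is [q (q - 1) h / 2], at least [q h / 2]. This [h] makes the
   second-order error [9 q ^ 3 h ^ 2] equal to [q h / 4]. *)
pose h : R := (36 * q%:R ^+ 2)^-1.
have q2sq : 4 <= q%:R ^+ 2 :> R by rewrite expr2; nra.
have hE : 36 * q%:R ^+ 2 * h = 1 by rewrite mulfV //; lra.
have h0 : 0 < h by rewrite invr_gt0; lra.
have h1 : h <= 1 by nra.
have h01 : 0 <= h <= 1 by rewrite ltW.
exists (1 - h); first by nra.
(* The quadratic bounds are summed over [i], with the sum of the squares [i ^ 2] bounded by
   [n ^ 3]. *)
have sum_le n : \sum_(i < n) (1 - h) ^+ (3 * i) <=
    n%:R - 3 / 2 * n%:R * (n%:R - 1) * h + 9 * n%:R ^+ 3 * h ^+ 2.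
  elim: n => [|n IHn]; first by rewrite big_ord0; lra.
  rewrite big_ord_recr /= -natr1; have /andP[_] := exprn_quadratic_bounds (3 * n) h01.
  rewrite natrM; have : (0 : R) <= n%:R by [].
  set m : R := n%:R in IHn *; set p := (1 - h) ^+ _; set S := \sum_(_ < _) _ in IHn *.
  move=> m0 pE; apply: le_trans (lerD IHn pE) _; rewrite -subr_ge0.
  rewrite [leRHS](_ : _ = 9 * h ^+ 2 * (2 * m ^+ 2 + 3 * m + 1)); last by field.
  by rewrite mulr_ge0 ?mulr_ge0 ?sqr_ge0 //; nra.
apply: le_lt_trans (sum_le q) _.
have /andP[lo _] := exprn_quadratic_bounds q.-1 h01.
apply: lt_le_trans (_ : q%:R * (1 - q.-1%:R * h) <= _); last by rewrite ler_wpM2l.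
have -> : q.-1%:R = q%:R - 1 :> R by rewrite -subn1 natrB // ltnW.
have e1 : 9 * q%:R ^+ 3 * h ^+ 2 = q%:R * h / 4 * (36 * q%:R ^+ 2 * h) by field.
rewrite e1 hE; set m : R := q%:R in q2R *.
have : 0 < m * h * (m - 1) / 2 - m * h / 4; last by lra.
have -> : m * h * (m - 1) / 2 - m * h / 4 = m * h * ((m - 1) / 2 - 1 / 4) by field.
by rewrite mulr_gt0 ?mulr_gt0 //; lra.
Qed.

(** Write [theta = expR (- a)] and use that [expR (N a)] exceeds its Taylor term of order [k.+1]. *)
Lemma poly_mul_geometric_bounded (R : realType) (k : nat) (theta : R) :
  0 < theta < 1 ->
  exists2 B : R, 0 < B & forall N : nat, N%:R ^+ k.+1 * theta ^+ N <= B.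
Proof.
move=> /andP[t0 t1]; pose a := - ln theta.
have a0 : 0 < a by rewrite oppr_gt0 ln_lt0 // t0.
have tE : theta = expR (- a) by rewrite opprK lnK.
exists ((k.+1)`!%:R / a ^+ k.+1).
  by rewrite divr_gt0 ?exprn_gt0 // ltr0n fact_gt0.
move=> N; rewrite tE -expRM_natl mulrN expRN ler_pdivlMr ?exprn_gt0 //.
rewrite mulrAC -exprMn ler_pdivrMr ?expR_gt0 //.
have Na0 : 0 <= N%:R * a by rewrite mulr_ge0 // ltW.
have := expR_ge1Dxn k Na0; rewrite -ler_pdivrMl ?ltr0n ?fact_gt0 // mulrC.
lra.
Qed.

(** Each alternative gives [n <= C0 * (theta * q) ^ N] with a common [theta < 1], and [theta ^ N]
    absorbs the power of [N]. The field comes after [C], which makes [C] uniform in it. *)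
Lemma solution_free_bound_dominated (R : realType) (q l k : nat) (b : R) :
  (2 <= q)%N -> 0 < b ->
  exists2 C : R, 0 < C &
    forall (F : finFieldType) (N n : nat), #|F| = q -> (2 <= N)%N ->
      [\/ n%:R <= b, (n <= 3 * #|small_expos F N (#|F|.-1 * (N + l))|)%N
        | (n ^ 2 <= 9 * #|F| ^ (N + l))%N] ->
      n%:R <= C * q%:R ^+ N * (ln (N%:R : R) ^+ 4 / N%:R) ^+ k.+1.
Proof.
move=> q2 b0; have q2R : (2 : R) <= q%:R by rewrite ler_nat.
have [y /andP[y0 y1] y_saves] := exists_saving_ratio R q2.
set S := \sum_(i < q) _ in y_saves.
have yq0 : 0 < y ^+ q.-1 by rewrite exprn_gt0.
have S0 : 0 <= S by apply: sumr_ge0 => i _; rewrite exprn_ge0 // ltW.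
have q0 : 0 < q%:R :> R by lra.
pose r := Num.sqrt (q%:R^-1 : R).
have r2 : r ^+ 2 = q%:R^-1 by rewrite sqr_sqrtr // invr_ge0 ltW.
have r0 : 0 < r by rewrite sqrtr_gt0 invr_gt0.
have r1 : r < 1.
  rewrite -(expr_lt1 (n := 2)) ?ltW // r2 invf_lt1 //; lra.
(* The first ratio serves the count of small exponents, the second, [q ^ (-1/2)], the bound on
   [n ^ 2]. *)
pose theta := Num.max (S / (q%:R * y ^+ q.-1)) r.
have r_le : r <= theta by rewrite le_max lexx orbT.
have t0 : 0 < theta by apply: lt_le_trans r_le.
have t1 : theta < 1.
  by rewrite gt_max r1 andbT ltr_pdivrMr ?mul1r // mulr_gt0.
have S_le : S <= theta * q%:R * y ^+ q.-1.
  by rewrite -mulrA -ler_pdivrMr ?mulr_gt0 // le_max lexx.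
have t2 : 1 <= theta ^+ 2 * q%:R.
  by rewrite -ler_pdivrMr // mul1r -r2 lerXn2r // nnegrE ltW.
have tq1 : 1 <= theta * q%:R by nra.
have [B B0 B_bound] : exists2 B : R, 0 < B &
    forall N : nat, N%:R ^+ k.+1 * theta ^+ N <= B.
  by apply: poly_mul_geometric_bounded; rewrite t0.
(* One summand for each alternative; the middle one undoes the part [y ^+ (q.-1 * l)] of
   [y ^+ D]. *)
pose C0 := b + 3 / y ^+ (q.-1 * l) + 3 * q%:R ^+ l.
have ql1 : 1 <= q%:R ^+ l :> R by rewrite exprn_ege1 //; lra.
have yl0 : 0 < 3 / y ^+ (q.-1 * l) by rewrite divr_gt0 // exprn_gt0.
have C00 : 0 < C0 by rewrite /C0; lra.
have ln2 : 0 < ln (2 : R) by rewrite ln_gt0 //; lra.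
(* The value at [N = 2], hence a lower bound for the logarithmic factor. *)
pose L : R := (ln 2 ^+ 4) ^+ k.+1.
have L0 : 0 < L by rewrite !exprn_gt0.
exists (C0 * B / L); first by rewrite divr_gt0 // mulr_gt0.
move=> F N n cardF N2 n_small.
have N0 : 0 < N%:R :> R by rewrite ltr0n (ltnW N2).
have n_le : n%:R <= C0 * (theta * q%:R) ^+ N.
  have tqN : 1 <= (theta * q%:R) ^+ N by rewrite exprn_ege1.
  have tqN0 : 0 <= (theta * q%:R) ^+ N by lra.
  suff : exists2 z, z <= C0 & n%:R <= z * (theta * q%:R) ^+ N.
    by case=> z zC0 /le_trans; apply; rewrite ler_wpM2r.
  case: n_small => [n_b|n_M|n_sq].
  - by exists b; [rewrite /C0; lra|nra].
  - exists (3 / y ^+ (q.-1 * l)); first by rewrite /C0; lra.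
    rewrite mulrAC ler_pdivlMr ?exprn_gt0 //.
    have y01 : 0 < y <= 1 by rewrite y0.
    have := card_small_expos_le F N (q.-1 * (N + l)) y01.
    have qE : #|F|.-1 = q.-1 by rewrite cardF.
    have -> : \sum_(i < #|F|) y ^+ (3 * i) = S by rewrite cardF.
    rewrite qE in n_M => M_le.
    have : S ^+ N <= (theta * q%:R) ^+ N * y ^+ (q.-1 * N).
      by rewrite exprM -exprMn lerXn2r // nnegrE ?mulr_ge0 // ltW.
    move=> /(le_trans M_le); rewrite mulnDr exprD mulrCA [leRHS]mulrC.
    rewrite ler_pM2l ?exprn_gt0 // => {}M_le.
    apply: le_trans (_ : 3 * #|small_expos F N (q.-1 * N + q.-1 * l)|%:R
      * y ^+ (q.-1 * l) <= _).
      rewrite ler_wpM2r ?(exprn_ge0 _ (ltW y0)) // -natrM ler_nat.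
      by rewrite -mulnDr.
    by rewrite -mulrA ler_wpM2l.
  - exists (3 * q%:R ^+ l); first by rewrite /C0; lra.
    have ql0 : 0 <= q%:R ^+ l :> R by lra.
    rewrite -ler_sqr ?nnegrE ?mulr_ge0 // -[n%:R ^+ 2]natrX.
    apply: le_trans (_ : (9 * q ^ (N + l))%:R <= _).
      by rewrite ler_nat -cardF.
    rewrite natrM natrX exprD.
    rewrite [leRHS](_ : _ = 9 * (q%:R ^+ N * q%:R ^+ l)
      * (q%:R ^+ l * (theta ^+ 2 * q%:R) ^+ N)); last first.
      have tN : (theta ^+ 2) ^+ N = (theta ^+ N) ^+ 2 by rewrite -!exprM mulnC.
      by rewrite [(theta * _) ^+ N]exprMn [(theta ^+ 2 * _) ^+ N]exprMn tN; ring.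
    rewrite ler_peMr ?mulr_ge0 ?exprn_ge0 //.
    by rewrite mulr_ege1 // exprn_ege1.
apply: le_trans n_le _.
have lnN : ln 2 <= ln N%:R :> R by rewrite ler_ln ?posrE ?ler_nat.
have : L <= (ln N%:R ^+ 4) ^+ k.+1.
  by rewrite !lerXn2r ?nnegrE ?exprn_ge0 //; lra.
rewrite expr_div_n; set LN := (ln N%:R ^+ 4) ^+ k.+1 => L_le.
have := B_bound N; set NK := N%:R ^+ k.+1.
have NK0 : 0 < NK by rewrite exprn_gt0.
rewrite exprMn => tN.
rewrite [leRHS](_ : _ = C0 * (B * q%:R ^+ N) * (LN / L) / NK); last first.
  by field; rewrite ?gt_eqF.
rewrite ler_pdivlMr // -!mulrA; apply: (ler_wpM2l (ltW C00)).
have qN0 : 0 < q%:R ^+ N :> R by rewrite exprn_gt0.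
rewrite [leLHS](_ : _ = (NK * theta ^+ N) * q%:R ^+ N); last by ring.
have LL : 1 <= LN / L by rewrite ler_pdivlMr // mul1r.
apply: le_trans (_ : B * q%:R ^+ N * 1 <= _).
  by rewrite mulr1 ler_wpM2r // ltW.
by rewrite mulrA ler_wpM2l // mulr_ge0 // ltW.
Qed.

(** * Combinatorics of solution-free sets *)

Lemma sqrn_le_half (n m : nat) :
  (1 < n)%N -> (n./2 * n./2 <= m)%N -> (n ^ 2 <= 9 * m)%N.
Proof.
move=> n1; have : (n <= 3 * n./2)%N by lia.
by rewrite expnS expn1; nia.
Qed.

Section SolutionFree.
Variables (F : finFieldType) (s : nat) (c : 'I_s -> {poly F}) (N : nat).
Implicit Types (A : {set {poly_N F}}) (P S : {set {set 'I_s}}).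

(** A trivial tuple is constant on each of [genus c] parts, so it takes at most one value per
    part. *)
Lemma trivial_tuple_card_values (x : 'I_s -> {poly_N F}) :
  trivial_tuple c (fun i => x i) -> (#|x @: setT| <= genus c)%N.
Proof.
case/existsP=> P /and3P[/andP[partP _] /eqP <- /forall_inP constP].
pose h (T : {set 'I_s}) := if [pick i in T] is Some i then x i else 0.
apply: leq_trans (leq_imset_card h P); apply: subset_leq_card.
apply/subsetP => _ /imsetP[i _ ->]; have iP : i \in cover P.
  by rewrite (cover_partition partP).
apply/imsetP; exists (pblock P i); first exact: pblock_mem.
rewrite /h; case: pickP => [j jP|/(_ i)]; last by rewrite mem_pblock iP.
have := constP _ (pblock_mem iP); move=> /forall_inP/(_ i).
rewrite mem_pblock => /(_ iP)/forall_inP/(_ j jP)/eqP eq_ij.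
exact: val_inj.
Qed.

Lemma exists_genus_partition :
  (0 < s)%N -> \sum_i c i = 0 ->
  exists2 P, zero_sum_partition c P & #|P| = genus c.
Proof.
move=> s0 c0; have := genus_gt0 s0 c0; rewrite /genus.
have [/existsP[P0 P0z]|/existsPn noP] := boolP [exists P, zero_sum_partition c P].
  have [|P Pz PE] := @eq_bigmax_cond _ (zero_sum_partition c) (fun P => #|P|).
    by apply/card_gt0P; exists P0.
  by exists P.
by rewrite big1 // => P Pz; have := noP P; rewrite Pz.
Qed.

(* Padding the unused parts with fresh pairwise distinct values would give a
   solution with more than [genus c] values, which cannot be trivial. *)
Lemma solution_free_card_values P S A (y : 'I_s -> {poly_N F}) :
  zero_sum_partition c P -> #|P| = genus c -> solution_free c A ->
  (2 * s <= #|A|)%N -> S \subset P ->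
  (forall i, i \in cover S -> y i \in A) ->
  \sum_(i in cover S) c i * y i = 0 ->
  (#|y @: cover S| <= #|S|)%N.
Proof.
move=> /andP[partP /forall_inP sumP] cardP freeA sA subSP yA ySol.
have tiP := partition_trivIset partP.
have covP i : i \in cover P by rewrite (cover_partition partP).
set V := y @: cover S; rewrite leqNgt; apply/negP => lt_SV.
have P_le : (#|P| <= s)%N.
  have := card_partition partP; rewrite cardsT card_ord => sE.
  have : (#|P| <= \sum_(B in P) #|B|)%N; last by rewrite -sE.
  rewrite -sum1_card; apply: leq_sum => B BP.
  by rewrite card_gt0 (partition_neq0 partP).
have V_le : (#|V| <= s)%N.
  rewrite (leq_trans (leq_imset_card _ _)) //.
  by have := max_card (mem (cover S)); rewrite card_ord.
(* Both [V] and [P] have at most [s] elements, so [2 * s] elements in [A] leave a fresh value for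
   every part. *)
have AV_ge : (#|P| <= #|A :\: V|)%N.
  have AV_le : (#|A :&: V| <= s)%N.
    exact: leq_trans (subset_leq_card (subsetIr A V)) V_le.
  by rewrite cardsD; lia.
pose f B := nth 0 (enum (A :\: V)) (index B (enum P)).
have index_lt B : B \in P -> (index B (enum P) < size (enum (A :\: V)))%N.
  move=> BP; apply: leq_trans (_ : size (enum P) <= _)%N; last by rewrite -!cardE.
  by rewrite index_mem mem_enum.
have fA B : B \in P -> f B \in A :\: V.
  by move=> BP; rewrite -mem_enum mem_nth // index_lt.
have f_inj : {in P &, injective f}.
  move=> B1 B2 B1P B2P /eqP; rewrite nth_uniq ?index_lt ?enum_uniq //.
  by move=> /eqP; apply: (@index_inj _ B1 (enum P)); rewrite mem_enum.
have notin_S B i : B \in P -> B \notin S -> i \in B -> i \notin cover S.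
  move=> BP BS iB; apply/negP => /bigcupP[B' B'S iB'].
  have := def_pblock tiP BP iB.
  by rewrite (def_pblock tiP (subsetP subSP _ B'S) iB') => EB; rewrite -EB B'S in BS.
pose x := [ffun i => if i \in cover S then y i else f (pblock P i)].
have xP B i : B \in P -> B \notin S -> i \in B -> x i = f B.
  move=> BP BS iB; rewrite ffunE (negPf (notin_S B i BP BS iB)).
  by rewrite (def_pblock tiP BP iB).
have xA i : x i \in A.
  rewrite ffunE; case: ifP => [/yA //|_].
  by have := fA _ (pblock_mem (covP i)); rewrite inE => /andP[].
(* Parts outside [S] contribute 0, since [x] is constant on them and their coefficients sum to 0. *)
have xSol : \sum_i c i * x i = 0.
  have -> : \sum_i c i * x i = \sum_(i in cover P) c i * x i.
    by apply: eq_bigl => i; rewrite covP.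
  rewrite big_trivIset // (bigID (mem S)) /= [X in _ + X]big1 => [|B].
    rewrite addr0 -[RHS]ySol big_trivIset; last exact: trivIsetS tiP.
    apply: eq_big => [B|B /andP[_ BS]].
      by rewrite andb_idl // => /(subsetP subSP).
    apply: eq_bigr => i iB; rewrite ffunE ifT //.
    by apply/bigcupP; exists B.
  move=> /andP[BP BS]; under eq_bigr => i iB do rewrite (xP B) //.
  by rewrite -mulr_suml (eqP (sumP B BP)) mul0r.
have : (#|x @: setT| <= genus c)%N.
  apply: trivial_tuple_card_values; move/forallP/(_ x): freeA.
  rewrite /nontrivial_solution xSol eqxx /= negbK => /implyP; apply.
  exact/forallP.
apply/negP; rewrite -ltnNge -cardP.
(* The tuple takes the more than [#|S|] values in [V] and [#|P :\: S|] fresh ones, in total more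
   than [#|P|]. *)
have cardPS : (#|P| = #|S| + #|P :\: S|)%N.
  by rewrite -(cardsID S P) (setIidPr subSP).
have cardf : #|f @: (P :\: S)| = #|P :\: S|.
  by apply: card_in_imset => B1 B2 /setDP[B1P _] /setDP[B2P _]; apply: f_inj.
have dis : V :&: f @: (P :\: S) = set0.
  apply/setP => v; rewrite !inE; apply/negP => /andP[vV /imsetP[B /setDP[BP _] vE]].
  by have := fA B BP; rewrite -vE inE vV.
have : (#|V :|: f @: (P :\: S)| <= #|x @: setT|)%N.
  apply: subset_leq_card; apply/subsetP => v /setUP[/imsetP[i iS ->]|].
    by apply/imsetP; exists i; rewrite ?ffunE ?iS.
  move=> /imsetP[B /setDP[BP BS] ->].
  have /set0Pn[i iB] := partition_neq0 partP BP.
  by apply/imsetP; exists i => //; rewrite (xP B).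
by rewrite cardsU dis cards0 cardf; lia.
Qed.

(** Applied to [S := [set T]], [solution_free_card_values] leaves a solution on [T] only one value.
    Keeping [i1] and [i2] and merging the other indices turns this into the three-variable diagonal
    condition. *)
Lemma card_solution_free_large_part P A (T : {set 'I_s}) l :
  (forall i, size (c i) <= l.+1)%N ->
  zero_sum_partition c P -> #|P| = genus c -> solution_free c A ->
  (2 * s <= #|A|)%N -> T \in P -> (2 < #|T|)%N ->
  (#|A| <= 3 * #|small_expos F N (#|F|.-1 * (N + l))|)%N.
Proof.
move=> size_c Pz cardP freeA sA TP /card_gt2P[i1 [i2 [i3 [[T1 T2 T3] [n12 n23 n31]]]]].
have T2' : i2 \in T :\ i1 by rewrite !inE eq_sym n12.
pose d := \sum_(i in T :\ i1 :\ i2) c i.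
have size_d : (size d <= l.+1)%N.
  by rewrite (leq_trans (size_sum _ _ _)) //; apply/bigmax_leqP.
apply: (card_only_diagonal_solutions (size_c i1) (size_c i2) size_d).
  have /andP[_ /forall_inP/(_ T TP)/eqP <-] := Pz.
  by rewrite (big_setD1 i1) //= (big_setD1 i2) //= addrA.
move=> x y z xA yA zA sol.
pose w i := if i == i1 then x else if i == i2 then y else z.
have := @solution_free_card_values P [set T] A w Pz cardP freeA sA.
rewrite sub1set cover1 cards1 => /(_ TP) w_const.
have w1 : w i1 = x by rewrite /w eqxx.
have w2 : w i2 = y by rewrite /w eq_sym (negPf n12) eqxx.
(* The third index guarantees that [z] is among the values of [w] on [T]. *)
have w3 : w i3 = z by rewrite /w (negPf n31) eq_sym (negPf n23).
have /card_le1_eqP w_eq : (#|w @: T| <= 1)%N.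
  apply: w_const => [i _|]; first by rewrite /w; case: ifP => // _; case: ifP.
  rewrite (big_setD1 i1) //= (big_setD1 i2) //= w1 w2 addrA -[RHS]sol.
  congr (_ + _); rewrite mulr_suml; apply: eq_bigr => i; rewrite !inE.
  by case/and3P=> [/negPf ni2 /negPf ni1 _]; rewrite /w ni1 ni2.
by split; rewrite -?w1 -?w2 -?w3; apply: w_eq; apply: imset_f.
Qed.

(** The two coefficients in a pair are opposite, so a collision of [c i1 * x + c i2 * y] is a
    solution on [T1 :|: T2], which may take only two values. The map is thus injective on a product
    of two halves of [A], with images of size at most [N + l]. *)
Lemma card_solution_free_pairs P A (T1 T2 : {set 'I_s}) l :
  (forall i, size (c i) <= l.+1)%N ->
  zero_sum_partition c P -> #|P| = genus c -> solution_free c A ->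
  (2 * s <= #|A|)%N -> (1 < #|A|)%N -> T1 \in P -> T2 \in P -> T1 != T2 ->
  #|T1| = 2 -> #|T2| = 2 ->
  (#|A| ^ 2 <= 9 * #|F| ^ (N + l))%N.
Proof.
move=> size_c Pz cardP freeA sA A1 T1P T2P nT.
move=> /eqP/cards2P[i1 [j1 [n1 ET1]]] /eqP/cards2P[i2 [j2 [n2 ET2]]].
(* Drawing [x] from [B] and [y] from its complement keeps their values apart, so two values in all
   force [x = x'] and [y = y']. *)
pose k := #|A|./2; pose B := [set x in take k (enum A)].
have sizek : size (take k (enum A)) = k.
  by rewrite size_takel // -cardE; lia.
have cardB : #|B| = k.
  by rewrite cardsE (card_uniqP _) ?take_uniq ?enum_uniq.
have BA : B \subset A.
  by apply/subsetP => x; rewrite inE => /mem_take; rewrite mem_enum.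
have cardAB : (k <= #|A :\: B|)%N by rewrite cardsDS // cardB; lia.
have cT1 : c j1 = - c i1.
  have /andP[_ /forall_inP/(_ T1 T1P)] := Pz.
  by rewrite ET1 big_setU1 ?inE //= big_set1 addrC addr_eq0 => /eqP.
have cT2 : c j2 = - c i2.
  have /andP[_ /forall_inP/(_ T2 T2P)] := Pz.
  by rewrite ET2 big_setU1 ?inE //= big_set1 addrC addr_eq0 => /eqP.
have disT : [disjoint T1 & T2].
  have /andP[/partition_trivIset/trivIsetP tiP _] := Pz.
  exact: tiP.
have subS : [set T1; T2] \subset P by rewrite subUset !sub1set T1P.
have coverS : cover [set T1; T2] = T1 :|: T2.
  by rewrite /cover big_setU1 ?inE //= big_set1.
have [i1T j1T i2T j2T] : [/\ i1 \in T1, j1 \in T1, i2 \in T2 & j2 \in T2].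
  by rewrite ET1 ET2 !inE !eqxx !orbT.
have ne12 u v : u \in T1 -> v \in T2 -> (v == u) = false.
  move=> uT vT; apply/eqP => Euv; move: disT.
  by rewrite disjoint_subset => /subsetP/(_ u uT); rewrite inE -Euv vT.
have noCollision (x x' y y' : {poly_N F}) :
    x \in B -> x' \in B -> y \in A :\: B -> y' \in A :\: B ->
    c i1 * x + c i2 * y = c i1 * x' + c i2 * y' ->
    (#|[set x; x'] :|: [set y; y']| <= 2)%N.
  move=> xB x'B yB y'B coll.
  pose w i := if i == i1 then x else if i == j1 then x' else
    if i == i2 then y else y'.
  have w1 : w i1 = x by rewrite /w eqxx.
  have w1' : w j1 = x' by rewrite /w eq_sym (negPf n1) eqxx.
  have w2 : w i2 = y by rewrite /w (ne12 i1) // (ne12 j1) // eqxx.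
  have w2' : w j2 = y' by rewrite /w (ne12 i1) // (ne12 j1) // eq_sym (negPf n2).
  have := @solution_free_card_values P [set T1; T2] A w Pz cardP freeA sA subS.
  rewrite coverS cards2 nT imsetU [in w @: T1]ET1 [in w @: T2]ET2.
  rewrite !imsetU1 !imset_set1 w1 w1' w2 w2'; apply.
    have yA : y \in A by case/setDP: yB.
    have y'A : y' \in A by case/setDP: y'B.
    have [xA x'A] : x \in A /\ x' \in A by rewrite !(subsetP BA).
    by move=> i _; rewrite /w; case: ifP => // _; case: ifP => // _; case: ifP.
  rewrite (eq_bigl [predU T1 & T2]) => [|i]; last by rewrite !inE.
  rewrite bigU //= ET1 ET2 !big_setU1 ?inE //= !big_set1.
  rewrite w1 w1' w2 w2' cT1 cT2.
  have -> : c i1 * x + - c i1 * x' + (c i2 * y + - c i2 * y') =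
    (c i1 * x + c i2 * y) - (c i1 * x' + c i2 * y') by ring.
  by rewrite coll subrr.
pose g (xy : {poly_N F} * {poly_N F}) : {poly_(N + l) F} :=
  npolyp (N + l) (c i1 * xy.1 + c i2 * xy.2).
have gE xy : g xy = c i1 * xy.1 + c i2 * xy.2 :> {poly F}.
  by rewrite npolypK // (leq_trans (size_polyD _ _)) // geq_max !size_mul_npoly.
have g_inj : {in setX B (A :\: B) &, injective g}.
  move=> [x y] [x' y'] /setXP[/= xB yB] /setXP[/= x'B y'B] /(congr1 val).
  rewrite /= !gE /= => coll.
  have := noCollision _ _ _ _ xB x'B yB y'B coll.
  have dis : [set x; x'] :&: [set y; y'] = set0.
    apply/setP => u; rewrite !inE; apply/negP => /andP[].
    move: yB y'B => /setDP[_ yB] /setDP[_ y'B].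
    by case/orP=> /eqP-> /orP[] /eqP E; move: yB y'B; rewrite -E ?xB ?x'B.
  rewrite cardsU dis cards0 subn0 !cards2.
  by case: eqP => [->|_]; case: eqP => [->|_].
suff : (k * k <= #|F| ^ (N + l))%N by exact: sqrn_le_half.
rewrite -card_npoly -{1}cardB; apply: leq_trans (leq_mul (leqnn _) cardAB) _.
by rewrite -cardsX -(card_in_imset g_inj) max_card.
Qed.

Lemma card_solution_free A l :
  (3 <= s)%N -> (forall i, c i != 0) -> \sum_i c i = 0 ->
  (forall i, size (c i) <= l.+1)%N -> solution_free c A ->
  [\/ (#|A| <= 2 * s)%N,
      (#|A| <= 3 * #|small_expos F N (#|F|.-1 * (N + l))|)%N
    | (#|A| ^ 2 <= 9 * #|F| ^ (N + l))%N].
Proof.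
move=> s3 c_neq0 c0 size_c freeA.
have [A_le|A_gt] := leqP #|A| (2 * s); first exact: Or31.
have sA := ltnW A_gt.
have [P Pz cardP] := exists_genus_partition (ltnW (ltnW s3)) c0.
have [/existsP[T /andP[TP T3]]|] := boolP [exists T in P, (2 < #|T|)%N].
  by apply: Or32; apply: card_solution_free_large_part TP T3.
move=> /exists_inPn small; have /andP[partP /forall_inP sumP] := Pz.
(* A singleton part would make some [c i] zero. *)
have cardT T : T \in P -> #|T| = 2.
  move=> TP; apply/eqP; rewrite eqn_leq leqNgt small //=.
  rewrite ltn_neqAle card_gt0 (partition_neq0 partP) // andbT eq_sym.
  apply/negP => /cards1P[i ET]; have := sumP T TP.
  by rewrite ET big_set1 (negPf (c_neq0 i)).
(* A single pair cannot cover [s >= 3] indices. *)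
have /card_gt1P[T1 [T2 [T1P T2P nT]]] : (1 < #|P|)%N.
  have := card_partition partP; rewrite cardsT card_ord.
  by rewrite (eq_bigr (fun=> 2%N)) // sum_nat_const; lia.
apply: Or33; apply: (card_solution_free_pairs size_c Pz cardP freeA sA _ T1P T2P);
  rewrite ?cardT //; lia.
Qed.

End SolutionFree.

Theorem theorem1p3 (R : realType) (q s ell : nat)
    (hq : exists p k : nat, [/\ prime p, (0 < k)%N & q = (p ^ k)%N])
    (hs : (3 <= s)%N) :
  exists2 C : R, 0 < C &
    forall (F : finFieldType) (c : 'I_s -> {poly F}),
      #|F| = q ->
      (forall i : 'I_s, c i != 0) ->
      \sum_(i < s) c i = 0 ->
      (\max_(i < s) (size (c i)).-1)%N = ell ->
      forall N : nat, (2 <= N)%N ->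
        (max_solution_free c N)%:R
          <= C * q%:R ^+ N * (ln (N%:R : R) ^+ 4 / N%:R) ^+ (s - 2).
Proof.
have q2 : (2 <= q)%N.
  have [p [k [p_pr k0 ->]]] := hq.
  by apply: leq_trans (prime_gt1 p_pr) _; rewrite -[leqLHS]expn1 leq_pexp2l // prime_gt0.
have b0 : 0 < (2 * s)%:R :> R by rewrite ltr0n; lia.
(* The lemma bounds with exponent [k.+1], so [k = s - 3] yields [s - 2]. *)
have [C C0 C_bound] := solution_free_bound_dominated ell (s - 3) q2 b0.
exists C => // F c cardF c_neq0 c0 ellE N N2.
have -> : (s - 2)%N = (s - 3).+1 by lia.
have size_c i : (size (c i) <= ell.+1)%N.
  rewrite -ellE; apply: leq_trans (leqSpred _) _; rewrite ltnS.
  exact: (leq_bigmax (F := fun i => (size (c i)).-1)).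
rewrite /max_solution_free; elim/big_ind: _ => [|m n m_le n_le|A freeA].
- by apply: (C_bound F N 0%N cardF N2); apply: Or31; rewrite ler0n.
- by rewrite /maxn; case: ifP.
apply: (C_bound F N _ cardF N2).
have [A_le|A_le|A_le] := card_solution_free hs c_neq0 c0 size_c freeA.
- by apply: Or31; rewrite ler_nat.
- exact: Or32.
- exact: Or33.
Qed.
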